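(* Let $A\in\mathbb{R}^{m\times n}$ and let $\mathbf{b}=[\underline b,\overline b]\subseteq\mathbb{R}^m$, $\mathbf{c}=[\underline c,\overline c]\subseteq\mathbb{R}^n$ be interval vectors. The type (B) interval linear program with degenerated matrix $\min\{\mathbf{c}^{\top}x : Ax\le\mathbf{b}\}$ has strongly zero duality gap if and only if at least one of the following conditions holds: (i) the linear system $Ax\le\underline{b}$ is feasible; (ii) for each $p\in\{\pm1\}^n$ the linear system $A^{\top}y=c_c+\mathrm{diag}(p)\,c_\Delta,\ y\le 0$ is feasible.
   Context: For $\underline b\le\overline b$ (entrywise), $\mathbf{b}=[\underline b,\overline b]=\{b:\underline b\le b\le\overline b\}$, and similarly for $\mathbf{c}$. $c_c=\frac12(\underline c+\overline c)$, $c_\Delta=\frac12(\overline c-\underline c)$, and $\mathrm{diag}(p)$ is the diagonal matrix with diagonal entries the entries of $p$. The interval linear program is the family of linear programs $\min\{c^{\top}x: Ax\le b\}$ over all scenarios $(A,b,c)$ with $b\in\mathbf{b}$, $c\in\mathbf{c}$ and the fixed real matrix $A$ (''degenerated matrix''). The dual of the scenario $(A,b,c)$ is $\max\{b^{\top}y: A^{\top}y=c,\ y\le 0\}$. A scenario has zero duality gap if and only if at least one of its primal and dual linear programs is feasible (otherwise the duality gap is $\infty$). The duality gap of the interval linear program is strongly zero if all scenarios have zero duality gap. *)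

(* Defs.v *)
From HB Require Import structures.
From mathcomp Require Import all_boot all_order all_algebra.
From mathcomp Require Import boolp classical_sets reals constructive_ereal ereal.

Set Implicit Arguments.
Unset Strict Implicit.
Unset Printing Implicit Defensive.

Import Order.TTheory GRing.Theory Num.Theory.

Local Open Scope classical_set_scope.
Local Open Scope ring_scope.

Section IntervalVectors.
Context {R : realType} {k : nat}.
Implicit Types u v lo hi : 'cV[R]_k.

Definition vec_le u v : Prop := forall i, u i 0 <= v i 0.

Definition interval_vec lo hi : set 'cV[R]_k :=
  [set v | vec_le lo v /\ vec_le v hi].

Definition vec_center lo hi : 'cV[R]_k := 2^-1 *: (lo + hi).

Definition vec_radius lo hi : 'cV[R]_k := 2^-1 *: (hi - lo).

Definition sign_vec (p : 'cV[R]_k) : Prop := forall i, p i 0 = 1 \/ p i 0 = -1.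

Definition vec_dot u v : R := (u^T *m v) 0 0.

End IntervalVectors.

Section LinearPrograms.
Context {R : realType} {m n : nat}.
Implicit Types (A : 'M[R]_(m, n)) (b : 'cV[R]_m) (c : 'cV[R]_n).

Definition primal_feasible_set A b : set 'cV[R]_n :=
  [set x | vec_le (A *m x) b].

Definition dual_feasible_set A c : set 'cV[R]_m :=
  [set y | A^T *m y = c /\ vec_le y 0].

(* Optimal values are extended reals: an infeasible minimization has value +oo,
   an infeasible maximization has value -oo. *)
Definition primal_value A b c : \bar R :=
  ereal_inf [set (vec_dot c x)%:E | x in primal_feasible_set A b].

Definition dual_value A b c : \bar R :=
  ereal_sup [set (vec_dot b y)%:E | y in dual_feasible_set A c].

(* Equality rather than a vanishing difference in \bar R: when both values are
   -oo (unbounded primal), or both +oo (unbounded dual), the gap is zero, whereas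
   subtraction in \bar R would return an infinity. *)
Definition zero_duality_gap A b c : Prop := primal_value A b c = dual_value A b c.

Definition strongly_zero_duality_gap A (bb : set 'cV[R]_m) (cc : set 'cV[R]_n) :
    Prop :=
  forall b c, bb b -> cc c -> zero_duality_gap A b c.

End LinearPrograms.

(* Main.v *)
Require Import Defs.
From mathcomp Require Import all_boot all_order all_algebra.
From mathcomp Require Import boolp classical_sets reals constructive_ereal ereal.
From mathcomp Require Import ring lra.

Set Implicit Arguments.
Unset Strict Implicit.
Unset Printing Implicit Defensive.

Import Order.TTheory GRing.Theory Num.Theory.

Local Open Scope classical_set_scope.
Local Open Scope ring_scope.

(** The heart of the matter is strong duality: a scenario whose primal or dual
    is feasible has zero duality gap, while a scenario where both are infeasible
    has primal value +oo and dual value -oo.  Granting this, the theorem is a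
    statement about feasibility.

    If the gap is strongly zero and [A x <= blo] is infeasible, then the
    scenarios with right-hand side [blo] must all be dual feasible, in particular
    those whose objective is one of the vertices [c_c + diag(p) c_Delta] of the
    box of objectives.  Conversely, a solution of [A x <= blo] solves
    [A x <= b] for every [b >= blo]; and since the objectives [c] for which
    [A^T y = c, y <= 0] is feasible form a convex set, this set contains the
    whole box as soon as it contains the vertices ([box_convex_ind]).

    Strong duality ([zero_gap_of_feasible]) comes from the affine Farkas lemma
    ([farkas]), itself obtained by Fourier-Motzkin elimination of one variable at
    a time.  Given a real upper bound [t] of the dual values, Farkas is applied
    to the system [A x <= b, c^T x <= t].  Take nonnegative weights for which the
    left-hand sides cancel.  If the objective row has positive weight, then the
    other weights, divided by minus that weight, form a dual solution; if it has
    weight zero, the negated weights form a recession direction of the dual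
    ([dual_ray_le0]).  In both cases the combined right-hand side is nonnegative,
    so the system is solvable and the primal value is at most [t]. *)

(** * Farkas' lemma by Fourier-Motzkin elimination *)

Section Farkas.
Variable R : realFieldType.

(** The lower bounds on [t] come from the [j] with [al j < 0] and the upper bounds
    from the [i] with [0 < al i]; the second hypothesis says that each of the
    former is below each of the latter, so the least upper bound works, or the
    greatest lower bound when there are no upper bounds. *)
Lemma one_variable_feasible (I : finType) (al be : I -> R) :
  (forall i, al i = 0 -> 0 <= be i) ->
  (forall i j, 0 < al i -> al j < 0 -> 0 <= - al j * be i + al i * be j) ->
  exists t, forall i, al i * t <= be i.
Proof.
move=> h0 hpn.
case: (pickP (fun i => 0 < al i)) => [i0 hi0|noP].
  case: (@arg_minP _ _ _ i0 (fun i => 0 < al i) (fun i => be i / al i) hi0) => i hi hmin.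
  exists (be i / al i) => k.
  have [hk|hk|hk] := ltgtP (al k) 0.
  - have h := hpn _ _ hi hk.
    rewrite mulrA ler_pdivrMr //; lra.
  - by have := hmin _ hk; rewrite ler_pdivlMr // mulrC.
  - by rewrite hk mul0r h0.
case: (pickP (fun i => al i < 0)) => [i0 hi0|noN].
  case: (@arg_maxP _ _ _ i0 (fun i => al i < 0) (fun i => be i / al i) hi0) => i hi hmax.
  exists (be i / al i) => k.
  have [hk|hk|hk] := ltgtP (al k) 0.
  - by have := hmax _ hk; rewrite /= ler_ndivrMr // mulrC.
  - by rewrite noP in hk.
  - by rewrite hk mul0r h0.
exists 0 => k; rewrite mulr0; apply: h0; apply/eqP.
by case: ltgtP (noP k) (noN k) => // ->.
Qed.

(** In the form in which it composes with elimination: if every nonnegative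
    combination of the inequalities with vanishing left-hand side has a
    nonnegative right-hand side, the inequalities are solvable.  The index type
    varies in the induction, because eliminating a variable replaces the rows by
    pairs of rows. *)
Lemma farkas (n : nat) (I : finType) (a : I -> 'rV[R]_n) (b : I -> R) :
  (forall y : I -> R, (forall i, 0 <= y i) -> \sum_i y i *: a i = 0 ->
     0 <= \sum_i y i * b i) ->
  exists x : 'cV[R]_n, forall i, (a i *m x) 0 0 <= b i.
Proof.
elim: n I a b => [|n IHn] I a b hab.
  exists 0 => i; rewrite mulmx0 mxE.
  have := hab (fun j => (j == i)%:R) (fun j => ler0n _ _).
  rewrite thinmx0 => /(_ erefl).
  rewrite (bigD1 i) //= eqxx mul1r big1 ?addr0 // => j /negPf ->.
  by rewrite mul0r.
pose al i : R := a i 0 0.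
(* Weights of rows i and j in the combined row (i, j): they cancel the first
   coefficient, and keep the rows that do not involve the first variable. *)
pose u i j := if al i == 0 then 1
              else if (0 < al i) && (al j < 0) then - al j else 0.
pose v i j := if al i == 0 then 0
              else if (0 < al i) && (al j < 0) then al i else 0.
have u0 i j : 0 <= u i j.
  by rewrite /u; case: ifP => // _; case: ifP => // /andP[_ ?]; lra.
have v0 i j : 0 <= v i j.
  by rewrite /v; case: ifP => // _; case: ifP => // /andP[? _]; lra.
have uv i j : u i j * al i + v i j * al j = 0.
  rewrite /u /v; case: eqP => [->|_]; first by ring.
  by case: ifP => _; ring.
pose a' i : 'rV[R]_n := @rsubmx R 1 1 n (a i).
have aL i : a i 0 (@lshift 1 n 0) = al i by congr (a i _ _); exact/val_inj.
have aR i l : a i 0 (@rshift 1 n l) = a' i 0 l.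
  by rewrite mxE; congr (a i _ _).
have aE i : a i = row_mx (al i)%:M (a' i) :> 'rV[R]_(1 + n).
  rewrite -[LHS](@hsubmxK R 1 1 n); congr row_mx.
  by apply/rowP => k; rewrite !ord1 !mxE mulr1n aL.
have [|x' hx'] := IHn (I * I)%type
    (fun k => u k.1 k.2 *: a' k.1 + v k.1 k.2 *: a' k.2)
    (fun k => u k.1 k.2 * b k.1 + v k.1 k.2 * b k.2).
  move=> y y0 hy.
  (* Weights of the original rows in the given combination of combined rows. *)
  pose z k := \sum_j y (k, j) * u k j + \sum_i y (i, k) * v i k.
  have zE (V : lmodType R) (f : I -> V) : \sum_k z k *: f k =
      \sum_k y k *: (u k.1 k.2 *: f k.1 + v k.1 k.2 *: f k.2).
    transitivity (\sum_i \sum_j y (i, j) *: (u i j *: f i + v i j *: f j));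
      last by rewrite pair_bigA; apply: eq_bigr => -[].
    under [RHS]eq_bigr do under eq_bigr do rewrite scalerDr !scalerA.
    under [RHS]eq_bigr do rewrite big_split.
    rewrite big_split /= [X in _ + X]exchange_big -big_split /=.
    by apply: eq_bigr => k _; rewrite scalerDl !scaler_suml.
  have -> : \sum_k y k * (u k.1 k.2 * b k.1 + v k.1 k.2 * b k.2) =
            \sum_k z k * b k by exact: esym (zE R^o b).
  apply: hab => [k|].
    by rewrite addr_ge0 // sumr_ge0 // => i _; rewrite mulr_ge0.
  have /= za' := zE _ a'; rewrite hy in za'.
  have /= zal := zE R^o al.
  rewrite [RHS]big1 in zal; last by move=> k _; rewrite [X in _ *: X]uv scaler0.
  apply/rowP => k; rewrite summxE mxE.
  under eq_bigr do rewrite mxE.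
  have [-> | [l ->]] : k = @lshift 1 n 0 \/ exists l, k = @rshift 1 n l.
    by case: (@splitP 1 n k) => l hl; [left|right; exists l];
      apply/val_inj => //=; rewrite hl ?ord1.
    by under eq_bigr do rewrite aL; exact: zal.
  under eq_bigr do rewrite aR.
  have /rowP/(_ l) := za'; rewrite summxE [RHS]mxE => za'l; apply: etrans za'l.
  by apply: eq_bigr => i _; rewrite [RHS]mxE.
pose be i := b i - (a' i *m x') 0 0.
have hbe i j : 0 <= u i j * be i + v i j * be j.
  have := hx' (i, j).
  by rewrite /= mulmxDl -!scalemxAl !mxE /be; rewrite !mxE; lra.
have [i hi|i j hi hj|t ht] := @one_variable_feasible I al be.
- by have := hbe i i; rewrite /u /v hi eqxx mul1r mul0r addr0.
- by have := hbe i j; rewrite /u /v gt_eqF // hi hj.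
exists (col_mx t%:M x' : 'cV[R]_(1 + n)) => i.
rewrite aE (@mul_row_col R 1 1 n 1) -scalar_mxM !mxE mulr1n.
by have := ht i; rewrite /be !mxE; lra.
Qed.

End Farkas.

(** * Linear programming duality *)

Lemma sum_option (V : nmodType) (I : finType) (F : option I -> V) :
  \sum_i F i = F None + \sum_i F (Some i).
Proof.
rewrite (bigD1 None) //= (reindex_omap Some id) => [|[]//].
by congr (_ + _); apply: eq_bigl => i; rewrite eqxx.
Qed.

Section Duality.
Variables (R : realType) (m n : nat).
Implicit Types (A : 'M[R]_(m, n)) (b : 'cV[R]_m) (c : 'cV[R]_n).

Lemma vec_dotE k (u v : 'cV[R]_k) : vec_dot u v = \sum_i u i 0 * v i 0.
Proof. by rewrite /vec_dot mxE; apply: eq_bigr => i _; rewrite mxE. Qed.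

Lemma vec_dot_adjoint A (x : 'cV[R]_n) (y : 'cV[R]_m) :
  vec_dot (A *m x) y = vec_dot (A^T *m y) x.
Proof.
rewrite /vec_dot !trmx_mul trmxK.
by rewrite -[RHS]trace_mx11 -mxtrace_tr !trmx_mul trmxK mulmxA trace_mx11.
Qed.

Lemma vec_dot_le_npos k (u v y : 'cV[R]_k) :
  vec_le u v -> vec_le y 0 -> vec_dot v y <= vec_dot u y.
Proof.
move=> uv y0; rewrite !vec_dotE; apply: ler_sum => i _.
by apply: ler_wnM2r (uv i); have := y0 i; rewrite mxE.
Qed.

Lemma weak_duality A b c x y :
  primal_feasible_set A b x -> dual_feasible_set A c y ->
  vec_dot b y <= vec_dot c x.
Proof.
by move=> hx [<- hy]; rewrite -vec_dot_adjoint; exact: vec_dot_le_npos.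
Qed.

(** A recession direction of the dual cannot increase a bounded dual objective:
    if the primal is feasible this is weak duality for the objective 0, and if
    the dual is feasible it follows by moving far along the direction. *)
Lemma dual_ray_le0 A b c (t : R) (r : 'cV[R]_m) :
  primal_feasible_set A b !=set0 \/ dual_feasible_set A c !=set0 ->
  (forall y, dual_feasible_set A c y -> vec_dot b y <= t) ->
  dual_feasible_set A 0 r -> vec_dot b r <= 0.
Proof.
move=> hfeas hub hr.
case: hfeas => [[x hx]|[y0 [hy0 y0le]]].
  have := weak_duality hx hr.
  by rewrite [leRHS]vec_dotE big1 // => i _; rewrite mxE mul0r.
have [hr0 rle] := hr.
rewrite leNgt; apply/negP => hpos.
have ht : vec_dot b y0 <= t by exact: hub.
(* The step length at which the objective reaches t + 1. *)
pose k := (t + 1 - vec_dot b y0) / vec_dot b r.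
have k0 : 0 <= k by apply: divr_ge0; lra.
have : vec_dot b (y0 + k *: r) <= t.
  apply: hub; split; first by rewrite mulmxDr -scalemxAr hr0 scaler0 addr0.
  move=> i; rewrite !mxE; have := y0le i; have := rle i; rewrite !mxE => ri yi.
  by have := mulr_ge0_le0 k0 ri; lra.
have -> : vec_dot b (y0 + k *: r) = vec_dot b y0 + k * vec_dot b r.
  by rewrite /vec_dot mulmxDr -scalemxAr !mxE.
by rewrite /k divfK ?gt_eqF //; lra.
Qed.

(** The attained form of strong duality.  Taking [t] to be the dual value, or an
    arbitrary real when that value is -oo, bounds the primal value by the dual
    one. *)
Lemma primal_le_of_dual_ub A b c (t : R) :
  primal_feasible_set A b !=set0 \/ dual_feasible_set A c !=set0 ->
  (forall y, dual_feasible_set A c y -> vec_dot b y <= t) ->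
  exists2 x, primal_feasible_set A b x & vec_dot c x <= t.
Proof.
move=> hfeas hub.
(* The index None stands for the inequality c^T x <= t. *)
pose a (i : option 'I_m) := if i is Some i then row i A else c^T.
pose d (i : option 'I_m) := if i is Some i then b i 0 else t.
have [y y0 hy|x hx] := @farkas R n (option 'I_m) a d; last first.
  exists x => [i|]; last exact: (hx None).
  by have := hx (Some i); rewrite /= -row_mul mxE.
rewrite !sum_option /= in hy *; set s := y None in hy *.
pose w : 'cV[R]_m := \col_i y (Some i).
have hw : s *: c + A^T *m w = 0.
  apply: trmx_inj; rewrite raddfD /= linearZ /= trmx_mul trmxK trmx0 -hy.
  congr (_ + _); rewrite mulmx_sum_row.
  by apply: eq_bigr => i _; rewrite !mxE.
have -> : \sum_i y (Some i) * b i 0 = vec_dot b w.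
  by rewrite vec_dotE; apply: eq_bigr => i _; rewrite mxE mulrC.
have s0 : 0 <= s by exact: y0.
have dotZ k : vec_dot b (k *: w) = k * vec_dot b w.
  by rewrite /vec_dot -scalemxAr mxE.
have wle k : k <= 0 -> vec_le (k *: w) 0.
  by move=> k0 i; rewrite !mxE mulr_le0_ge0.
have [sE|sN] := eqVneq s 0.
  rewrite sE scale0r add0r in hw; rewrite sE mul0r add0r.
  have := @dual_ray_le0 A b c t (-1 *: w) hfeas hub.
  rewrite dotZ mulN1r oppr_le0; apply; split.
    by rewrite -scalemxAr hw scaler0.
  by apply: wle; lra.
have spos : 0 < s by rewrite lt_def sN.
have := hub (- s^-1 *: w); rewrite dotZ.
have hd : dual_feasible_set A c (- s^-1 *: w).
  split; last by apply: wle; rewrite oppr_le0 invr_ge0.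
  have -> : A^T *m (- s^-1 *: w) = - s^-1 *: (A^T *m w) by rewrite -scalemxAr.
  have -> : A^T *m w = - (s *: c) by apply/eqP; rewrite -addr_eq0 addrC hw.
  by rewrite scalerN scaleNr opprK scalerA mulVf // scale1r.
move=> /(_ hd); rewrite mulNr lerNl mulrC ler_pdivlMr //; lra.
Qed.

Lemma zero_gap_of_feasible A b c :
  primal_feasible_set A b !=set0 \/ dual_feasible_set A c !=set0 ->
  zero_duality_gap A b c.
Proof.
move=> hfeas; apply/eqP; rewrite eq_le; apply/andP; split; last first.
  apply: ge_ereal_sup => _ [y hy <-]; apply: le_ereal_inf_tmp => _ [x hx <-].
  by rewrite lee_fin; exact: weak_duality hx hy.
have key (t : R) :
    (dual_value A b c <= t%:E)%E -> (primal_value A b c <= t%:E)%E.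
  move=> ht.
  have [|x hx hxt] := primal_le_of_dual_ub (t := t) hfeas.
    move=> y hy; rewrite -lee_fin; apply: le_trans ht.
    by apply: ereal_sup_ubound; exists y.
  apply: (@le_trans _ _ (vec_dot c x)%:E); last by rewrite lee_fin.
  by apply: ereal_inf_lbound; exists x.
case E : (dual_value A b c) => [r||]; last 2 first.
- by rewrite leey.
- by rewrite [primal_value _ _ _]eq_ninfty // => t; apply: key; rewrite E leNye.
- by apply: key; rewrite E.
Qed.

(** With both programs infeasible, the gap is between +oo and -oo. *)
Lemma feasible_of_zero_gap A b c : zero_duality_gap A b c ->
  primal_feasible_set A b !=set0 \/ dual_feasible_set A c !=set0.
Proof.
rewrite /zero_duality_gap /primal_value /dual_value.
have [-> |/set0P ?] := eqVneq (primal_feasible_set A b) set0; last by left.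
have [-> |/set0P ?] := eqVneq (dual_feasible_set A c) set0; last by right.
by rewrite !image_set0 ereal_inf0 ereal_sup0.
Qed.

Lemma dual_feasible_convex A (u v : 'cV[R]_n) (t : R) : 0 <= t <= 1 ->
  dual_feasible_set A u !=set0 -> dual_feasible_set A v !=set0 ->
  dual_feasible_set A (t *: u + (1 - t) *: v) !=set0.
Proof.
move=> /andP[t0 t1] [y [<- yle]] [z [<- zle]].
exists (t *: y + (1 - t) *: z); split.
  by rewrite mulmxDr -!scalemxAr.
move=> i; have := yle i; have := zle i; rewrite !mxE => ? ?; nra.
Qed.

End Duality.

(** * Boxes and their vertices *)

Section Box.
Variables (R : realType) (n : nat) (lo hi : 'cV[R]_n).

Definition vertex (p : 'cV[R]_n) : 'cV[R]_n :=
  vec_center lo hi + diag_mx p^T *m vec_radius lo hi.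

Lemma vertexE p i :
  vertex p i 0 = 2^-1 * (lo i 0 + hi i 0) + p i 0 * (2^-1 * (hi i 0 - lo i 0)).
Proof. by rewrite mxE mul_diag_mx !mxE. Qed.

Lemma vertex_in_box p :
  vec_le lo hi -> sign_vec p -> interval_vec lo hi (vertex p).
Proof.
move=> lohi sp; split=> i; rewrite vertexE;
  have := lohi i; case: (sp i) => ->; lra.
Qed.

(** One coordinate at a time: a point of the box lies on the segment joining the
    two points obtained by moving its coordinate [k] to either end. *)
Lemma box_convex_ind (P : 'cV[R]_n -> Prop) :
  (forall u v t, 0 <= t <= 1 -> P u -> P v -> P (t *: u + (1 - t) *: v)) ->
  (forall p, sign_vec p -> P (vertex p)) ->
  forall c, interval_vec lo hi c -> P c.
Proof.
move=> Pconv Pvert.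
have step (k : nat) (c : 'cV[R]_n) : interval_vec lo hi c ->
    (forall i : 'I_n, (k <= i)%N -> c i 0 = lo i 0 \/ c i 0 = hi i 0) -> P c.
  elim: k c => [|k IHk] c hc hk.
    pose p : 'cV[R]_n := \col_i (if c i 0 == hi i 0 then 1 else -1).
    have -> : c = vertex p.
      apply/colP => i; rewrite vertexE mxE.
      case: eqP => [-> | chi]; first by lra.
      by case: (hk i (leq0n _)) => // ->; lra.
    by apply: Pvert => i; rewrite mxE; case: ifP; [left|right].
  have [kn|nk] := ltnP k n; last first.
    by apply: IHk => // i; rewrite leqNgt (leq_trans (ltn_ord i)).
  pose j := Ordinal kn.
  pose set_j (e : R) : 'cV[R]_n := \col_i (if i == j then e else c i 0).
  have [clo chi] := hc.
  have ljhj : lo j 0 <= hi j 0 := le_trans (clo j) (chi j).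
  have Pset e : e = lo j 0 \/ e = hi j 0 -> P (set_j e).
    move=> he; apply: IHk.
      by split=> i; rewrite mxE; case: eqP => [-> |_] //; case: he => ->.
    move=> i ki; rewrite mxE; case: eqP => [-> |/eqP ij] //.
    apply: hk; rewrite ltn_neqAle ki andbT.
    by apply: contraNneq ij => kE; apply/eqP/val_inj; rewrite /= kE.
  have [ejl|ejl] := eqVneq (lo j 0) (hi j 0).
    suff -> : c = set_j (lo j 0) by apply: Pset; left.
    apply/colP => i; rewrite mxE; case: eqP => [-> |//].
    by apply/eqP; rewrite eq_le clo ejl chi.
  have dpos : 0 < hi j 0 - lo j 0 by rewrite subr_gt0 lt_def eq_sym ejl.
  (* Barycentric coordinate of c_j in [lo_j, hi_j]. *)
  pose t := (hi j 0 - c j 0) / (hi j 0 - lo j 0).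
  have -> : c = t *: set_j (lo j 0) + (1 - t) *: set_j (hi j 0).
    apply/colP => i; rewrite !mxE; case: eqP => [-> |_]; last by ring.
    by rewrite /t; field; rewrite gt_eqF.
  apply: Pconv; [|by apply: Pset; left|by apply: Pset; right].
  rewrite /t divr_ge0 ?subr_ge0 ?chi //= ler_pdivrMr // mul1r.
  by rewrite lerD2l lerN2.
move=> c hc; apply: (step n) => // i.
by rewrite leqNgt ltn_ord.
Qed.

End Box.

(** * Strongly zero duality gap *)

Theorem corollary10 (R : realType) (m n : nat) (A : 'M[R]_(m, n))
    (blo bhi : 'cV[R]_m) (clo chi : 'cV[R]_n)
    (hb : vec_le blo bhi) (hc : vec_le clo chi) :
  strongly_zero_duality_gap A (interval_vec blo bhi) (interval_vec clo chi) <->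
  (exists x : 'cV[R]_n, vec_le (A *m x) blo) \/
  (forall p : 'cV[R]_n, sign_vec p ->
     exists y : 'cV[R]_m,
       A^T *m y = vec_center clo chi + diag_mx p^T *m vec_radius clo chi /\
       vec_le y 0).
Proof.
split=> [hgap|hfeas b c hbb hcc].
  have [?|noprimal] := EM (exists x : 'cV[R]_n, vec_le (A *m x) blo).
    by left.
  right=> p sp.
  have hblo : interval_vec blo bhi blo by split.
  have [[x hx]|//] :=
    feasible_of_zero_gap (hgap _ _ hblo (vertex_in_box hc sp)).
  by case: noprimal; exists x.
apply: zero_gap_of_feasible; case: hfeas => [[x hx]|hdual].
  by left; exists x => i; apply: le_trans (hx i) _; case: hbb.
right; apply: (box_convex_ind (P := fun c => dual_feasible_set A c !=set0)) hcc.
  by move=> u v t; exact: dual_feasible_convex.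
exact: hdual.
Qed.
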